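(* For every finitely generated group $\Gamma$, $\mathtt{FFIID}(\Gamma) \subseteq \mathtt{BaireSHIFT}(\Gamma)$.
   Context: Let $\Gamma$ be a finitely generated group. A locally checkable labeling (LCL) problem on $\Gamma$ is a triple $\Pi = (W, \Lambda, \mathcal{A})$ where $W \subseteq \Gamma$ is a finite set, $\Lambda$ is a finite set (of labels, with the discrete topology), and $\mathcal{A} \subseteq \Lambda^W$ is a family of maps $W \to \Lambda$. Given an action of $\Gamma$ on a set $X$, a solution to $\Pi$ on $X$ is a function $f \colon X \to \Lambda$ such that for all $x \in X$, the map $W \to \Lambda$, $w \mapsto f(w \cdot x)$, is in $\mathcal{A}$. For a set $X$, the shift action of $\Gamma$ on $X^\Gamma$ is $(\gamma \cdot x)(\delta) = x(\delta\gamma)$. Its free part is $\mathcal{F}(X,\Gamma) = \{x \in X^\Gamma : \gamma \cdot x \neq x \text{ for all non-identity } \gamma \in \Gamma\}$. Write $2 = \{0,1\}$ with the discrete topology; $\mathcal{F}(2,\Gamma)$ carries the topology inherited from the product topology on $2^\Gamma$. The set $\mathcal{F}([0,1],\Gamma)$ is equipped with (the restriction of) the product measure $\mathcal{L}^\Gamma$, where $\mathcal{L}$ is Lebesgue measure on $[0,1]$; measurability and ''almost every'' on $\mathcal{F}([0,1],\Gamma)$ refer to this measure. Two points $x,x' \in \mathcal{F}([0,1],\Gamma)$ agree on $D \subseteq \Gamma$ if $x(\gamma) = x'(\gamma)$ for all $\gamma \in D$. A measurable function $f \colon \mathcal{F}([0,1],\Gamma) \to \Lambda$ is finitary if for almost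 every $x \in \mathcal{F}([0,1],\Gamma)$ there is a finite set $D_x \subseteq \Gamma$ such that $f(x) = f(x')$ whenever $x' \in \mathcal{F}([0,1],\Gamma)$ agrees with $x$ on $D_x$. Classes of LCL problems $\Pi$ on $\Gamma$: - $\Pi \in \mathtt{FFIID}(\Gamma)$ iff $\Pi$ has a finitary solution on $\mathcal{F}([0,1],\Gamma)$. - $\Pi \in \mathtt{BaireSHIFT}(\Gamma)$ iff $\Pi$ has a Baire-measurable solution on $\mathcal{F}(2,\Gamma)$. *)

(* Defs.v *)
From HB Require Import structures.
From mathcomp Require Import all_boot all_order all_algebra finmap.
From mathcomp Require Import all_classical all_reals all_analysis.
From mathcomp Require Import measurable_realfun.

Set Implicit Arguments.
Unset Strict Implicit.
Unset Printing Implicit Defensive.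

Import Order.TTheory GRing.Theory Num.Theory.

Local Open Scope classical_set_scope.

Definition finitely_generated (G : groupType) : Prop :=
  exists S : {fset G}, forall H : set G,
    H 1%g -> (forall x y, H x -> H y -> H (x / y)%g) ->
    (forall s, s \in S -> H s) -> H = setT.

Section Shift.
Variables (X : Type) (G : groupType).

Definition shift_act (g : G) (x : G -> X) : G -> X := fun d => x (d * g)%g.

Definition free_part : set (G -> X) :=
  [set x | forall g : G, g <> 1%g -> shift_act g x <> x].

Lemma shift1 x : shift_act 1%g x = x.
Proof. by apply/funext => d; rewrite /shift_act mulg1. Qed.

Lemma shiftM g h x : shift_act (g * h)%g x = shift_act g (shift_act h x).
Proof. by apply/funext => d; rewrite /shift_act mulgA. Qed.

Lemma free_part_shift g x : free_part x -> free_part (shift_act g x).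
Proof.
move=> Fx h h1 hgx; apply: (Fx (g^-1 * (h * g))%g).
  by move=> /(congr1 (fun k => g * k * g^-1)%g); rewrite mulVKg mulgK mulg1 mulgV.
by rewrite shiftM shiftM hgx -shiftM mulVg shift1.
Qed.

Definition free_shift (g : G) (x : free_part) : free_part :=
  SigSub (mem_set (@free_part_shift g (set_val x) (set_valP x))).

End Shift.
Arguments free_part X G : clear implicits.

Record LCL (G : groupType) := MkLCL {
  window : {fset G};
  labels : finType;
  allowed : {set {ffun window -> labels}} }.

Definition solution (G : groupType) (X : Type) (act : G -> X -> X)
    (Pi : LCL G) (f : X -> labels Pi) : Prop :=
  forall x : X, [ffun w : window Pi => f (act (val w) x)] \in allowed Pi.

Section BaireCategory.
Variable T : topologicalType.
Implicit Types A : set T.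

Definition nowhere_dense A : Prop := interior (closure A) = set0.

Definition meager A : Prop :=
  exists2 N : nat -> set T, (forall n, nowhere_dense (N n)) & A `<=` \bigcup_n N n.

Definition baire_property A : Prop :=
  exists2 U : set T, open U & meager (A `+` U).

(* the target [L] is discrete, so all of its subsets are open *)
Definition baire_measurable (L : finType) (f : T -> L) : Prop :=
  forall B : set L, baire_property (f @^-1` B).

End BaireCategory.

Definition BaireSHIFT (G : groupType) (Pi : LCL G) : Prop :=
  exists f : (free_part bool G : set (prod_topology (fun _ : G => bool))) ->
             labels Pi,
    solution (@free_shift bool G) f /\ baire_measurable f.

Section IID.
Variables (R : realType) (G : groupType).

Definition unit_itv : Type := (`[0%R, 1%R] : set R).

Lemma unit_itv0 : (0%R : R) \in (`[0%R, 1%R] : set R).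
Proof. by rewrite inE /= in_itv /= lexx ler01. Qed.

HB.instance Definition _ := Choice.on unit_itv.
HB.instance Definition _ := isPointed.Build unit_itv (SigSub unit_itv0).

Definition box (D : {fset G}) (B : G -> set R) : set (G -> unit_itv) :=
  [set x | forall g, g \in D -> B g (set_val (x g))].

Definition measurable_boxes : set (set (G -> unit_itv)) :=
  [set box D B | D in [set: {fset G}]
               & B in [set B : G -> set R | forall g, measurable (B g)]].

Definition product_space := g_sigma_algebraType measurable_boxes.

(* The library has no infinite product of measures, so the product measure
   [Lebesgue^G] on [[0,1]^G] is specified by its values on boxes. The boxes are a
   pi-system generating the product sigma-algebra, so at most one probability
   satisfies this; it exists by the classical product-measure theorem. *)
Definition is_product_lebesgue (P : probability product_space R) : Prop :=
  forall (D : {fset G}) (B : G -> set R), (forall g, measurable (B g)) ->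
    P (box D B) =
      (\prod_(g <- D) lebesgue_measure (B g `&` `[0%R, 1%R]))%E.

Definition agree (D : {fset G}) (x y : G -> unit_itv) : Prop :=
  forall g, g \in D -> x g = y g.

Section Finitary.
Variables (P : probability product_space R) (L : finType).
Variable f : free_part unit_itv G -> L.

(* [free_part] is a conull subset of the product space (G countable), so the
   restriction of the measure to it is handled through images under [set_val];
   measurability is with respect to the completed measure. *)
Definition free_measurable : Prop :=
  forall B : set L, completed_algebra_gen P (set_val @` (f @^-1` B)).

Definition finitary : Prop :=
  free_measurable /\
  P.-negligible (set_val @` [set x : free_part unit_itv G |
    ~ exists D : {fset G}, forall y : free_part unit_itv G,
        agree D (set_val x) (set_val y) -> f x = f y]).

End Finitary.

Definition FFIID (Pi : LCL G) : Prop :=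
  exists P : probability product_space R, is_product_lebesgue P /\
    exists f : free_part unit_itv G -> labels Pi,
      solution (@free_shift unit_itv G) f /\ finitary P f.

End IID.

(* Main.v *)
Require Import Defs.
From HB Require Import structures.
From mathcomp Require Import all_boot all_order all_algebra finmap.
From mathcomp Require Import all_classical all_reals all_analysis.
From mathcomp Require Import measurable_realfun.

(** Let [f] be a finitary solution on the free part of [[0,1]^G].

    If [G] is finite, every subset of the free part of [2^G] is open, and the
    inclusion of [2] into [[0,1]] pulls [f] back to a solution.

    If [G] is infinite, no equivariant map from [2^G] to [[0,1]^G] is chosen:
    only the values of [f] are fixed, while the real labels that produce them
    stay free to be resampled. The objects involved are islands. An island
    consists of a cylinder of [2^G] (its code), a finite set of coordinates
    (its buffer), a non-null event of [[0,1]^G] that depends only on the buffer,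
    and a colour, the value of [f] at all free points of the event. A point [x]
    of [2^G] whose shift by [g] lies in the code asks that the shift by [g] of a
    point of [[0,1]^G] lie in the event. The islands are built one after the
    other so that, for every [x], any finitely many of these requests are met
    together on a non-null set.

    To add an island inside a given cylinder ([add_island]), extend the cylinder
    by zeros to a finitely supported point [x0] with trivial stabilizer. Codes
    contain a 1, so only finitely many old islands occur in [x0]; their requests
    hold jointly on a non-null set, and as [f] is finitary, on a non-null part of
    it the value of [f] is determined by finitely many coordinates: this part is
    the new event ([nonnegligible_determined]). The new code prescribes [x0] on a
    set so large that any old island whose buffer meets the new one is visible in
    [x0], hence already implied by the new event, and that two occurrences of the
    new code have disjoint buffers. The remaining requests have disjoint buffers,
    so they are jointly non-null by independence ([nonnegligible_setI]). This
    holds for arbitrary, possibly nonmeasurable, events with disjoint finite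
    supports, by Fubini's theorem for the map that splices two independent
    points together.

    Doing this for each of the countably many cylinders, the points all of whose
    shifts lie in some code form a comeager invariant set. Colour such a point
    by any island in whose code it lies. A common free witness of finitely many
    requests shows both that the colour is well defined, hence locally constant,
    and that the constraint at each point is the one satisfied by [f] at the
    witness ([coding_sequence]). On the invariant meager remainder, pull [f] back
    along the inclusion of [2] into [[0,1]]. *)

Set Implicit Arguments.
Unset Strict Implicit.
Unset Printing Implicit Defensive.

Import Order.TTheory GRing.Theory Num.Theory.

Local Open Scope classical_set_scope.

(** * Countability *)

Lemma countable_of_injection (T : Type) (c : T -> nat) :
  injective c -> countable [set: T].
Proof. by move=> cI; apply/countable_injP; exists c => x y _ _ /cI. Qed.

Lemma injection_of_countable (T : Type) :
  countable [set: T] -> exists c : T -> nat, injective c.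
Proof.
by move=> /countable_injP[c cI]; exists c => x y /cI; apply; rewrite inE.
Qed.

Lemma surjection_of_countable (T : Type) :
  T -> countable [set: T] -> exists e : nat -> T, forall t, exists n, e n = t.
Proof.
move=> t0 /injection_of_countable[c cI].
have /choice[e eP] : forall n, exists t, forall u, c u = n -> u = t.
  move=> n; have [[t <-]|nt] := pselect (exists t, c t = n).
    by exists t => u /cI.
  by exists t0 => u cu; case: nt; exists u.
by exists e => t; exists (c t); rewrite -(eP (c t) t).
Qed.

Lemma countable_fset_type (T : choiceType) :
  countable [set: T] -> countable [set: {fset T}].
Proof.
move=> /injection_of_countable[c cI].
apply: (@countable_of_injection {fset T}
  (fun E => choice.pickle [seq c t | t <- enum_fset E])).
move=> E F /(pcan_inj choice.pickleK) EF; apply/fsetP => t.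
by rewrite -[t \in E](mem_map cI) -[t \in F](mem_map cI) EF.
Qed.

Lemma countable_pair (T U : Type) :
  countable [set: T] -> countable [set: U] -> countable [set: T * U].
Proof. by move=> cT cU; rewrite -setXTT; exact: countableX. Qed.

(** The sets obtained from the generators by at most [n] rounds of divisions are
    finite, and their union is closed under division. *)
Lemma finitely_generated_countable (G : groupType) :
  finitely_generated G -> countable [set: G].
Proof.
move=> [S genS].
pose H := fix H n : {fset G} := if n is m.+1
  then (H m `|` [fset (x / y)%g | x in H m, y in H m])%fset
  else (1%g |` S)%fset.
have HS n : {subset H n <= H n.+1} by move=> x; rewrite in_fsetU => ->.
have Hle m n : (m <= n)%N -> {subset H m <= H n}.
  elim: n m => [|n IH] m; first by rewrite leqn0 => /eqP ->.
  by rewrite leq_eqVlt => /predU1P[-> //|/IH mn x /mn /HS].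
have <- : \bigcup_n [set` H n] = [set: G].
  apply: genS => [|x y [m _ /= xm] [n _ /= yn]|s sS].
  - by exists 0%N => //=; rewrite in_fsetU in_fset1 eqxx.
  - exists (maxn m n).+1 => //=; rewrite in_fsetU; apply/orP; right.
    apply/imfset2P; exists x; first exact: Hle (leq_maxl _ _) _ xm.
    by exists y => //; exact: Hle (leq_maxr _ _) _ yn.
  - by exists 0%N => //=; rewrite in_fsetU sS orbT.
by apply: bigcup_countable => // n _; exact: countable_fset.
Qed.

Lemma negligible_bigcup_countable d (T : measurableType d) (R : realType)
    (mu : {measure set T -> \bar R}%R) (I : Type) (F : I -> set T) :
  countable [set: I] -> (forall i, mu.-negligible (F i)) ->
  mu.-negligible (\bigcup_i F i).
Proof.
move=> /injection_of_countable[c cI] nF.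
apply: (@negligibleS _ _ _ _ (\bigcup_n \bigcup_(i in [set i | c i = n]) F i)).
  by move=> x [i _ Fx]; exists (c i) => //; exists i.
apply: negligible_bigcup => n.
have [[i <-]|ni] := pselect (exists i, c i = n).
  by apply: negligibleS (nF i) => x [j /= /cI ->].
apply: negligibleS (negligible_set0 _) => x [i /= ci _].
by case: ni; exists i.
Qed.

(** * The product measure: invariance and independence *)

Section ProductLebesgue.
Variables (R : realType) (G : groupType).
Local Notation X := (product_space R G).
Implicit Types (D E : {fset G}) (B : G -> set R) (A : set X).

Lemma measurable_box D B :
  (forall g, measurable (B g)) -> measurable (box D B : set X).
Proof. by move=> mB; apply: sub_sigma_algebra; exists D => //; exists B. Qed.

Lemma box_setI_closed : setI_closed (@measurable_boxes R G).
Proof.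
move=> _ _ [D _ [B mB <-]] [E _ [C mC <-]].
pose BC g := (if g \in D then B g else setT) `&` (if g \in E then C g else setT).
exists (D `|` E)%fset => //; exists BC.
  by move=> g; apply: measurableI; case: ifP.
apply/seteqP; split=> [x xBC|x [xB xC] g _].
  split=> g gD; have := xBC g; rewrite in_fsetU gD ?orbT => /(_ isT);
    by rewrite /BC gD => -[].
by split; case: ifP => // gD; [exact: xB|exact: xC].
Qed.

Lemma measurable_fun_boxes d (T : measurableType d) (phi : T -> X) :
  (forall D B, (forall g, measurable (B g)) ->
    measurable (phi @^-1` box D B)) ->
  measurable_fun setT phi.
Proof.
move=> mphi; apply: (@measurability _ _ T X setT phi (@measurable_boxes R G)) => //.
by move=> _ [_ [D _ [B mB <-]] <-]; rewrite setTI; exact: mphi.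
Qed.

Variable P : probability X R.

(** Boxes form a pi-system, so a map whose preimages of boxes have the right
    measure is measure preserving. *)
Lemma measure_preimage_boxes d (T : measurableType d)
    (mu : {measure set T -> \bar R}%R) (phi : T -> X) :
  (forall D B, (forall g, measurable (B g)) ->
    measurable (phi @^-1` box D B) /\ mu (phi @^-1` box D B) = P (box D B)) ->
  forall A, measurable A -> measurable (phi @^-1` A) /\ mu (phi @^-1` A) = P A.
Proof.
move=> mphi.
have mf : measurable_fun setT phi.
  by apply: (@measurable_fun_boxes d T) => D B mB; have [] := mphi D B mB.
move=> A mA; split; first by rewrite -[X in measurable X]setTI; exact: mf.
pose Q : {measure set X -> \bar R}%R :=
  measure_function_pushforward__canonical__measure_function_Measure mu mf.
rewrite -[LHS]/(Q A).
apply: (@measure_unique _ R X (@measurable_boxes R G) (fun=> setT)) => //.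
- exact: box_setI_closed.
- by move=> _; exists fset0 => //; exists (fun=> setT) => //; apply/seteqP; split.
- by rewrite bigcup_const.
- by move=> _ [D _ [B mB <-]]; exact: (mphi D B mB).2.
- move=> _; rewrite /Q /= /pushforward preimage_setT.
  have -> : [set: T] = phi @^-1` box fset0 (fun=> setT) by apply/seteqP; split.
  by rewrite (mphi _ _ _).2 //; apply: (le_lt_trans (probability_le1 _ _)) => //;
    [exact: measurable_box|rewrite ltry].
Qed.

Hypothesis HP : is_product_lebesgue P.

Lemma shift_preserves g A : measurable A ->
  measurable (shift_act g @^-1` A : set X) /\ P (shift_act g @^-1` A) = P A.
Proof.
move: A; apply: (@measure_preimage_boxes _ X P (shift_act g)) => D B mB.
have -> : shift_act g @^-1` box D B
    = box [fset d * g | d in D]%g%fset (fun d => B (d * g^-1)%g).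
  apply/seteqP; split=> x /= xB.
    by move=> _ /imfsetP[d /= dD ->]; rewrite mulgK; exact: xB.
  move=> d dD; have := xB (d * g)%g; rewrite mulgK; apply.
  by apply/imfsetP; exists d.
split; first by apply: measurable_box => d; exact: mB.
apply: etrans (HP _ (fun d => mB (d * g^-1)%g)) _.
rewrite HP // big_imfset /=; last by move=> a b _ _ /mulIg.
by apply: eq_bigr => d _; rewrite mulgK.
Qed.

Lemma negligible_shift g A :
  P.-negligible A -> P.-negligible (shift_act g @^-1` A : set X).
Proof.
move=> [N [mN N0 AN]]; have [mgN gN0] := shift_preserves g mN.
by exists (shift_act g @^-1` N); split=> //; [rewrite gN0|move=> x /AN].
Qed.

(** The point that agrees with the first component on [D] and with the second one
    elsewhere. *)
Definition splice D (xy : X * X) : X :=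
  fun g => if g \in D then xy.1 g else xy.2 g.

(** Independence of the coordinates in [D] from the others. *)
Lemma splice_preserves D A : measurable A ->
  measurable (splice D @^-1` A) /\ (P \x P)%E (splice D @^-1` A) = P A.
Proof.
move: A; apply: measure_preimage_boxes => E B mB.
have -> : splice D @^-1` box E B
    = (box [fset g in E | g \in D]%fset B : set X)
      `*` (box [fset g in E | g \notin D]%fset B : set X).
  apply/seteqP; split=> [[x y] /= xyB|[x y] /= [xB yB] g gE].
    by split=> g /=; rewrite !inE /= => /andP[gE gD];
      have := xyB g gE; rewrite /splice ?gD ?(negPf gD).
  by rewrite /splice; case: ifPn => gD; [apply: xB|apply: yB];
    rewrite !inE /= gE gD.
split; first by apply: measurableX; exact: measurable_box.
apply: etrans (product_measure1E P P (measurable_box _ mB) (measurable_box _ mB)) _.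
rewrite HP // (big_fsetID _ (fun g => g \in D)) /=.
by congr (_ * _)%E; exact: HP.
Qed.

(** Two non-null events that depend on complementary sets of coordinates have a
    non-null intersection. Neither event needs to be measurable: if [N] is a
    null set containing [A `&` A'], then for almost every [x], hence for some [x]
    in [A], the set of the [y] such that the splicing of [x] and [y] lies in [N]
    is null; it contains [A']. *)
Lemma nonnegligible_setI D (A A' : set X) :
  (forall x y, agree D x y -> A x -> A y) ->
  (forall x y, (forall g, g \notin D -> x g = y g) -> A' x -> A' y) ->
  ~ P.-negligible A -> ~ P.-negligible A' -> ~ P.-negligible (A `&` A').
Proof.
move=> DA DA' nA nA' [N [mN N0 AN]].
have [mS S0] := splice_preserves D mN; rewrite N0 in S0.
have mf := measurable_fun_xsection P mS.
have /(ae_eq_integral_abs P measurableT mf).1 nS :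
    (\int[P]_x `|(P \o xsection (splice D @^-1` N)) x|)%E = 0%E.
  by rewrite -[RHS]S0; apply: eq_integral => x _; rewrite gee0_abs.
apply: nA; apply: negligibleS nS => x Ax /= xS; apply: nA'.
exists (xsection (splice D @^-1` N) x); split.
- exact: measurable_xsection.
- exact: xS.
- move=> y A'y; rewrite /xsection /= inE; apply: AN; split.
    by apply: DA Ax => g gD; rewrite /splice gD.
  by apply: DA' A'y => g gD; rewrite /splice (negPf gD).
Qed.

End ProductLebesgue.

(** * Almost every point is injective *)

Section AlmostEverywhereInjective.
Variables (R : realType) (G : groupType).
Local Notation X := (product_space R G).
Variable P : probability X R.
Hypothesis HP : is_product_lebesgue P.

Lemma measurable_coordinate (a : G) :
  measurable_fun setT (fun x : X => set_val (x a) : R).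
Proof.
move=> _ B mB; rewrite setTI.
have -> : (fun x : X => set_val (x a) : R) @^-1` B = box [fset a]%fset (fun=> B).
  by apply/seteqP; split=> x /= xB => [g /fset1P ->|]; [|apply: xB; apply/fset1P].
exact: measurable_box.
Qed.

(** By splicing at [a], the coordinate at [a] becomes independent from the one at
    [b], and the sections of the event are null boxes because points of [R] are
    null for the Lebesgue measure. *)
Lemma negligible_equal_coordinates (a b : G) :
  a != b -> P.-negligible [set x : X | x a = x b].
Proof.
move=> ab.
set N : set X := [set x | x a = x b].
have mN : measurable N.
  have -> : N = [set: X] `&`
      ((fun x : X => set_val (x a) - set_val (x b) : R)%R @^-1` [set 0%R]).
    rewrite setTI; apply/seteqP; split=> x /= [xab]; first by rewrite xab subrr.
    by apply: val_inj; apply/eqP; rewrite -subr_eq0 xab.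
  apply: measurable_funB; [exact: measurable_coordinate..| |] => //.
exists N; split=> //.
have [_ <-] := splice_preserves HP [fset a]%fset mN.
apply: integral0_eq => x _ /=.
have -> : xsection (splice [fset a]%fset @^-1` N) x
    = box [fset b]%fset (fun=> [set set_val (x a)]).
  apply/seteqP; split=> y; rewrite /xsection /= inE /N /= /splice in_fset1 eqxx.
    rewrite in_fset1 eq_sym (negPf ab) /= => xy g /fset1P ->.
    by rewrite xy.
  rewrite in_fset1 eq_sym (negPf ab) => /(_ b); rewrite in_fset1 eqxx => /(_ isT).
  by move=> /val_inj.
apply: etrans (HP _ _) _ => //; rewrite big_seq_fset1.
apply/eqP; rewrite eq_le measure_ge0 andbT.
rewrite -(lebesgue_measure_set1 (set_val (x a))) le_measure // ?inE //.
exact: measurableI.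
Qed.

Lemma negligible_not_injective : countable [set: G] ->
  P.-negligible [set x : X | ~ injective x].
Proof.
move=> cG.
pose F (ab : G * G) : set X :=
  if ab.1 == ab.2 then set0 else [set x | x ab.1 = x ab.2].
apply: (@negligibleS _ _ _ _ (\bigcup_ab F ab)).
  move=> x /= xI; apply: contrapT => xF; apply: xI => a b xab.
  apply/eqP/negPn/negP => ab; apply: xF; exists (a, b) => //.
  by rewrite /F (negPf ab).
apply: negligible_bigcup_countable; first exact: countable_pair.
move=> [a b]; rewrite /F /=; have [_|ab] := eqVneq a b.
  exact: negligible_set0.
exact: negligible_equal_coordinates.
Qed.

Lemma injective_free (T : Type) (x : G -> T) : injective x -> free_part T G x.
Proof.
move=> xI g g1 gx; apply: g1; apply: xI.
by have := congr1 (@^~ 1%g) gx; rewrite /shift_act mul1g.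
Qed.

End AlmostEverywhereInjective.

(** * Islands *)

(** Equality of two configurations on a finite set, with arbitrary labels; for
    labels in the unit interval it unfolds to the same formula as [agree]. *)
Definition agree_on (G : groupType) (T : Type) (D : {fset G}) (x y : G -> T) :=
  forall g, g \in D -> x g = y g.

Lemma fset_family_bound (I : eqType) (T : choiceType) (s : seq I)
    (F : I -> {fset T}) :
  exists U : {fset T}, forall i, i \in s -> {subset F i <= U}.
Proof.
elim: s => [|i s [U sU]]; first by exists fset0.
exists (F i `|` U)%fset => j; rewrite in_cons => /predU1P[->|/sU jU] t.
  by rewrite in_fsetU => ->.
by move=> /jU tU; rewrite in_fsetU tU orbT.
Qed.

Lemma infinite_fresh (T : choiceType) :
  ~ finite_set [set: T] -> forall D : {fset T}, exists a, a \notin D.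
Proof.
move=> infT D; apply: contrapT => noa; apply: infT.
apply: sub_finite_set (finite_fset D) => t _ /=.
by apply/negPn/negP => tD; apply: noa; exists t.
Qed.

(** In an infinite group, the restriction to [E] of the indicator function of [S]
    extends to the indicator function of a nonempty finite set with trivial
    stabilizer. Two fresh points [a] and [b], and then a point [c] far from
    everything else, are added: a translation that preserves the resulting set
    and is not trivial would move both [a] and [b] to [c]. *)
Lemma finite_set_free_translate (G : groupType) : ~ finite_set [set: G] ->
  forall (S E : {fset G}), exists T : {fset G},
    [/\ T != fset0, forall e, e \in E -> (e \in T) = (e \in S) &
        free_part bool G (fun d => d \in T)].
Proof.
move=> /infinite_fresh fresh S E.
have [a aE] := fresh E; have [b] := fresh (a |` E)%fset.
rewrite !inE negb_or => /andP[ba bE].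
pose T0 := (a |` (b |` [fset e in E | e \in S]))%fset.
pose K := [fset (r * v)%g | r in [fset (t / u)%g | t in T0, u in T0]%fset, v in T0]%fset.
have [c] := fresh (E `|` (T0 `|` K))%fset.
rewrite in_fsetU negb_or in_fsetU negb_or => /and3P[cE cT0 cK].
have cK' t u v : t \in T0 -> u \in T0 -> v \in T0 -> c <> (t / u * v)%g.
  move=> tT uT vT ctuv; case/negP: cK; rewrite ctuv.
  apply/imfset2P; exists (t / u)%g; last by exists v.
  by apply/imfset2P; exists t => //; exists u.
exists (c |` T0)%fset; split.
- by apply/fset0Pn; exists c; rewrite fset1U1.
- move=> e eE; have ne d : d \notin E -> (e == d) = false.
    by move=> dE; apply/eqP => ed; rewrite -ed eE in dE.
  by rewrite !inE !ne //= eE.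
- move=> g g1 gT.
  have {}gT d : ((d * g)%g \in (c |` T0)%fset) = (d \in (c |` T0)%fset).
    exact: (congr1 (@^~ d) gT).
  have inT d : (d \in (c |` T0)%fset) = (d == c) || (d \in T0).
    exact: in_fset1U.
  (* if a point of T0 stays in T0, then c is moved into T0, hence c is in K *)
  have T0c t : t \in T0 -> (t * g)%g = c.
    move=> tT; have := gT t; rewrite !inT tT orbT => /orP[/eqP //|tgT].
    have := gT c; rewrite !inT eqxx /= => /orP[/eqP cg|cgT].
      by case: g1; apply: (mulgI c); rewrite cg mulg1.
    case: (cK' _ _ _ cgT tgT tT).
    by rewrite invgM mulgA mulgK mulgVK.
  case/eqP: ba; apply: (mulIg g).
  by rewrite !T0c // /T0 !inE eqxx ?orbT.
Qed.

Section Islands.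
Variables (R : realType) (G : groupType).
Local Notation X := (product_space R G).
Variable P : probability X R.
Hypothesis HP : is_product_lebesgue P.
Hypothesis cG : countable [set: G].
Variables (L : finType) (f : free_part (unit_itv R) G -> L).
Hypothesis ff : finitary P f.

(** An island is the request that [event] hold, made at each point of [2^G] that
    agrees with [code] on [code_dom]. The function [code] is total, but only its
    restriction to [code_dom] matters for its occurrences. *)
Record island := Island {
  code : G -> bool;
  code_dom : {fset G};
  buffer : {fset G};
  event : set X;
  color : L }.

(* Classical equality test, which allows lists of islands to be used as sets. *)
HB.instance Definition _ := gen_eqMixin island.

(** The island [i] occurs at position [g] of [x]. *)
Definition occurs (i : island) (g : G) (x : G -> bool) :=
  agree_on (code_dom i) (shift_act g x) (code i).

(** The conjunction of the requests made by a list of occurrences. *)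
Definition joint_event (l : seq (island * G)) : set X :=
  [set y | forall ig, ig \in l -> event ig.1 (shift_act ig.2 y)].

(** Well-formed islands. The 1 in the code ensures that the island has finitely
    many occurrences in a finitely supported configuration. *)
Definition island_wf (i : island) :=
  [/\ forall y z, agree_on (buffer i) y z -> event i y -> event i z,
      exists2 e, e \in code_dom i & code i e,
      ~ P.-negligible (event i) &
      forall y, event i (set_val y) -> f y = color i].

(** Any finitely many requests made by the islands of [s] in a common
    configuration hold jointly on a non-null set. *)
Definition consistent (s : seq island) :=
  forall x l, (forall ig, ig \in l -> ig.1 \in s /\ occurs ig.1 ig.2 x) ->
    ~ P.-negligible (joint_event l).

Lemma joint_event_local (l : seq (island * G)) (y z : X) :
  (forall ig, ig \in l -> island_wf ig.1) ->
  (forall ig d, ig \in l -> d \in buffer ig.1 ->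
    y (d * ig.2)%g = z (d * ig.2)%g) ->
  joint_event l y -> joint_event l z.
Proof.
move=> wfl yz ly ig igl; have [loc _ _ _] := wfl _ igl.
by apply: loc (ly _ igl) => d dB; exact: yz.
Qed.

Lemma nonnegligible_shift g (A : set X) :
  ~ P.-negligible A -> ~ P.-negligible (shift_act g @^-1` A : set X).
Proof.
move=> nA /(negligible_shift HP g^-1%g) ngA; apply: nA; apply: negligibleS ngA.
by move=> y Ay /=; rewrite -shiftM mulgV shift1.
Qed.

Lemma nonnegligible_joint_event_cons i g (l : seq (island * G)) :
  island_wf i -> (forall ig, ig \in l -> island_wf ig.1) ->
  (forall ig d e, ig \in l -> d \in buffer ig.1 -> e \in buffer i ->
    (d * ig.2)%g <> (e * g)%g) ->
  ~ P.-negligible (joint_event l) ->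
  ~ P.-negligible (joint_event ((i, g) :: l)).
Proof.
move=> [loc _ ni _] wfl dis nl.
pose D := [fset e * g | e in buffer i]%g%fset.
have : ~ P.-negligible (shift_act g @^-1` event i `&` joint_event l).
  apply: (@nonnegligible_setI _ _ _ HP D) => //.
  - move=> x y xy; apply: loc => d dB; apply: xy.
    by apply/imfsetP; exists d.
  - move=> x y xy; apply: joint_event_local => // ig d igl dB; apply: xy.
    by apply/imfsetP => -[e /= eB]; exact: dis igl dB eB.
  - exact: nonnegligible_shift.
apply: contra_not; apply: negligibleS => y [yi yl] ig.
by rewrite in_cons => /predU1P[->|/yl].
Qed.

(** Almost every point is injective, hence free. *)
Lemma nonnegligible_free (A : set X) : ~ P.-negligible A ->
  exists y : free_part (unit_itv R) G, A (set_val y).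
Proof.
move=> nA; apply: contrapT => noy; apply: nA.
apply: negligibleS (negligible_not_injective HP cG) => y Ay yI; apply: noy.
by exists (SigSub (mem_set (injective_free yI))).
Qed.

(** This is where finitarity is used: up to a null set, the space is the union of
    countably many sets on each of which finitely many coordinates force
    [f] to take a fixed value. *)
Lemma nonnegligible_determined (A : set X) : ~ P.-negligible A ->
  exists (c : L) (D : {fset G}), ~ P.-negligible (A `&`
    [set y | forall z, agree_on D y (set_val z) -> f z = c]).
Proof.
move=> nA; apply: contrapT => noD; apply: nA.
pose F (cD : L * {fset G}) : set X := A `&`
  [set y | forall z, agree_on cD.2 y (set_val z) -> f z = cD.1].
have nF : P.-negligible (\bigcup_cD F cD).
  apply: negligible_bigcup_countable.
    by apply: countable_pair; [exact: countableP|exact: countable_fset_type].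
  by move=> [c D]; apply: contrapT => nF; apply: noD; exists c, D.
apply: negligibleS (negligibleU (negligibleU
  (negligible_not_injective HP cG) ff.2) nF) => y Ay.
have [yI|yI] := pselect (injective y); last by left; left.
pose yf : free_part (unit_itv R) G := SigSub (mem_set (injective_free yI)).
have [[D yD]|noDy] := pselect (exists D : {fset G}, forall z, 
    agree D (set_val yf) (set_val z) -> f yf = f z); last first.
  by left; right; exists yf.
right; exists (f yf, D) => //; split=> // z yz /=.
by apply/esym; apply: yD.
Qed.

Lemma occurrences_finite (s : seq island) (T : {fset G}) :
  (forall i, i \in s -> island_wf i) ->
  exists l : seq (island * G), forall ig,
    (ig \in l) <-> (ig.1 \in s /\ occurs ig.1 ig.2 (fun d => d \in T)).
Proof.
move=> wfs; have [U sU] := fset_family_bound s code_dom.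
pose K := [fset (e^-1 * t)%g | e in U, t in T]%fset.
exists [seq ig <- allpairs pair s K | `[< occurs ig.1 ig.2 (fun d => d \in T) >]].
move=> [i g]; rewrite mem_filter; split=> [/andP[/asboolP oig]|[/= si oig]].
  by move=> /allpairsP[[j h] /= [sj _ [ij _]]]; split=> //; rewrite ij.
apply/andP; split; first exact/asboolP.
apply/allpairsP; exists (i, g); split=> //=.
have [_ [e ei ce] _ _] := wfs i si.
apply/imfset2P; exists e; first exact: sU ei.
exists (e * g)%g; last by rewrite mulKg.
by move: (oig e ei); rewrite /shift_act ce.
Qed.

Lemma consistent_nil : consistent [::].
Proof.
move=> x [|ig l] oc; last by have [] := oc ig (mem_head _ _).
have -> : joint_event [::] = setT by apply/seteqP; split.
move=> /negligibleP => /(_ measurableT) P0.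
by have /eqP := etrans (esym (probability_setT P)) P0; rewrite onee_eq0.
Qed.


(** The inductive step: a consistent list of islands can be enlarged by an island
    whose code refines any given cylinder, the one of the configurations equal to
    the indicator function of [S] on [E]. *)
Lemma add_island (s : seq island) (S E : {fset G}) :
  ~ finite_set [set: G] ->
  (forall i, i \in s -> island_wf i) -> consistent s ->
  exists i, [/\ island_wf i, consistent (i :: s), free_part bool G (code i),
    agree_on E (fun d => d \in S) (code i) & {subset E <= code_dom i}].
Proof.
move=> infG wfs cons.
have [T [T0 TS freeT]] := finite_set_free_translate infG S E.
pose x0 : G -> bool := fun d => d \in T.
have [l0 l0P] := occurrences_finite T wfs.
have wfl0 ig : ig \in l0 -> island_wf ig.1 by move=> /l0P[/wfs].
have nl0 : ~ P.-negligible (joint_event l0) by apply: (cons x0) => ig /l0P.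
have [c [D1 nA]] := nonnegligible_determined nl0.
set A := (_ `&` _) in nA.
have [D0 D0P] := fset_family_bound l0
  (fun ig => [fset (d * ig.2)%g | d in buffer ig.1]%fset).
pose D := (D0 `|` D1)%fset.
have [U UP] := fset_family_bound s code_dom.
have [B BP] := fset_family_bound s buffer.
(* [w h] is a coordinate where [x0] differs from its shift by [h] *)
have /choice[w wP] : forall h, exists d, h <> 1%g -> x0 (d * h)%g <> x0 d.
  move=> h; have [->|h1] := pselect (h = 1%g); first by exists 1%g.
  apply: contrapT => noh; apply: (freeT h h1); apply/funext => d.
  by apply: contrapT => hd; apply: noh; exists d.
pose H := [fset (a^-1 * b)%g | a in D, b in D]%fset.
pose BD := [fset (b^-1 * d)%g | b in B, d in D]%fset.
pose V := [fset (e * g)%g | e in U, g in BD]%fset.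
pose W := ([fset w h | h in H] `|` [fset (w h * h)%g | h in H])%fset.
(* [V] reveals the old islands whose buffers meet [D], [W] prevents two
   occurrences of the new code from having overlapping buffers *)
pose E' := (E `|` (T `|` (V `|` W)))%fset.
pose new := Island x0 E' D A c.
have wfnew : island_wf new.
  split => //=.
  - move=> y z yz [yl yD]; split.
      apply: joint_event_local yl => // ig d igl dB; apply: yz.
      rewrite in_fsetU (D0P ig igl) //; apply/imfsetP; by exists d.
    move=> u zu; apply: yD => g gD; rewrite yz ?zu // in_fsetU gD orbT //.
  - by have /fset0Pn[e eT] := T0; exists e => //; rewrite !in_fsetU eT orbT.
  - by move=> y [_ yc]; apply: yc.
(* an old island whose buffer meets that of an occurrence of the new one
   is already forced by the event of the latter *)
have absorb x i g h b d y : i \in s -> occurs i g x -> occurs new h x ->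
    b \in buffer i -> d \in D -> (b * g)%g = (d * h)%g ->
    event new (shift_act h y) -> event i (shift_act g y).
  move=> si oi on bB dD bgdh [yl _].
  have gh : (g * h^-1)%g = (b^-1 * d)%g.
    by apply: (mulgI b); apply: (mulIg h); rewrite mulgA mulgVK bgdh mulVKg.
  have il : (i, g * h^-1)%g \in l0.
    apply/l0P; split=> //= e ei; rewrite -(oi e ei).
    have := on (e * (g * h^-1))%g; rewrite /shift_act /= -!mulgA mulVg mulg1.
    move=> -> //; rewrite !in_fsetU; apply/orP; right; apply/orP; right.
    apply/orP; left; apply/imfset2P; exists e; first exact: UP ei.
    exists (g * h^-1)%g => //; rewrite gh; apply/imfset2P.
    by exists b; [exact: BP bB|exists d].
  by have := yl _ il; rewrite /= -shiftM -mulgA mulVg mulg1.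
(* the buffers of two distinct occurrences of the new island are disjoint *)
have separate x g h a b : occurs new g x -> occurs new h x ->
    a \in D -> b \in D -> (a * g)%g = (b * h)%g -> g = h.
  move=> og oh aD bD abgh; apply: contrapT => gh.
  pose k := (b^-1 * a)%g.
  have hk : h = (k * g)%g by rewrite /k -mulgA abgh mulKg.
  have k1 : k <> 1%g by move=> k1; apply: gh; rewrite hk k1 mul1g.
  have kH : k \in H by apply/imfset2P; exists b => //; exists a.
  apply: (wP k k1); rewrite -[LHS](og (w k * k)%g) -?[RHS](oh (w k)).
  - by rewrite /shift_act hk -mulgA.
  - by rewrite /= !in_fsetU; do 3 (apply/orP; right); apply/orP; left;
      apply/imfsetP; exists k.
  - by rewrite /= !in_fsetU; do 4 (apply/orP; right); apply/imfsetP; exists k.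
exists new; split=> //; last 2 first.
- by move=> e eE; rewrite /= /x0 TS.
- by move=> e eE; rewrite /= in_fsetU eE.
move=> x l lP.
(* [M] lists the positions of the new island in [l]; the requests in [l1] are
   those that come from old islands and are not absorbed by the new one *)
pose M := undup [seq ig.2 | ig <- l & ig.1 == new].
have MP g : (g \in M) = ((new, g) \in l).
  rewrite mem_undup; apply/mapP/idP => [[[i h]]|gl].
    by rewrite mem_filter /= => /andP[/eqP -> ?] ->.
  by exists (new, g) => //; rewrite mem_filter eqxx gl.
have oM g : g \in M -> occurs new g x by rewrite MP => /lP[].
pose meets (ig : island * G) := exists b d h,
  [/\ b \in buffer ig.1, d \in D, h \in M & (b * ig.2)%g = (d * h)%g].
pose l1 := [seq ig <- l | (ig.1 != new) && ~~ `[< meets ig >]].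
have l1P ig : ig \in l1 -> [/\ ig \in l, ig.1 \in s & ~ meets ig].
  rewrite mem_filter => /andP[/andP[ign /asboolPn igm] igl]; split=> //.
  by have [] := lP ig igl; rewrite in_cons (negPf ign).
have nM (M' : seq G) : uniq M' -> {subset M' <= M} ->
    ~ P.-negligible (joint_event ([seq (new, g) | g <- M'] ++ l1)).
  elim: M' => [_ _|g M' IH /= /andP[gM' uM'] sM'].
    by apply: (cons x) => ig /l1P[/lP[_ ?] ? _].
  have gM : g \in M by apply: sM'; rewrite mem_head.
  have sM : {subset M' <= M} by move=> h hM'; apply: sM'; rewrite in_cons hM' orbT.
  apply: nonnegligible_joint_event_cons => //; last exact: IH.
    by move=> ig; rewrite mem_cat => /orP[/mapP[h _ ->]|/l1P[_ /wfs]].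
  move=> ig d e; rewrite mem_cat => /orP[/mapP[h hM' ->] /= dD eD dheg|].
    have hg := separate x h g d e (oM h (sM h hM')) (oM g gM) dD eD dheg.
    by rewrite -hg hM' in gM'.
  by move=> /l1P[_ _ igm] dB eD dge; apply: igm; exists d, e, g.
apply: contra_not (nM M (undup_uniq _) (fun _ => id)); apply: negligibleS.
move=> y yM [i g] igl /=.
have yh h : h \in M -> event new (shift_act h y).
  move=> hM; apply: (yM (new, h)); rewrite mem_cat; apply/orP; left.
  by apply/mapP; exists h.
have [inew|inew] := eqVneq i new.
  by rewrite inew; apply: yh; rewrite MP -inew.
have [[b [d [h [bB dD hM bgdh]]]]|igm] := pselect (meets (i, g)).
  have [/= is_ oi] := lP _ igl; rewrite in_cons (negPf inew) /= in is_.
  exact: absorb is_ oi (oM h hM) bB dD bgdh (yh h hM).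
apply: (yM (i, g)); rewrite mem_cat mem_filter igl inew /= andbT.
by apply/orP; right; apply/asboolPn.
Qed.


(** The measure-free outcome of the construction: codes [C n] on domains [E n],
    dense among the cylinders, with colours [c n], such that finitely many codes
    occurring in the same configuration are realized by the values of [f] along
    the orbit of a single free point. *)
Lemma coding_sequence : ~ finite_set [set: G] ->
  exists (C : nat -> G -> bool) (E : nat -> {fset G}) (c : nat -> L),
  [/\ forall n, free_part bool G (C n),
      forall S D : {fset G}, exists n,
        agree_on D (fun d => d \in S) (C n) /\ {subset D <= E n} &
      forall x (l : seq (nat * G)),
        (forall ng, ng \in l -> agree_on (E ng.1) (shift_act ng.2 x) (C ng.1)) ->
        exists y : free_part (unit_itv R) G,
          forall ng, ng \in l -> f (free_shift ng.2 y) = c ng.1].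
Proof.
move=> infG.
pose good s := (forall i, i \in s -> island_wf i) /\ consistent s.
pose extends (s : seq island) (SD : {fset G} * {fset G}) i :=
  [/\ good (i :: s), free_part bool G (code i),
    agree_on SD.2 (fun d => d \in SD.1) (code i) & {subset SD.2 <= code_dom i}].
have ext s SD : good s -> exists i, extends s SD i.
  move=> [wfs cs]; have [i [wi ci fi ai si]] := add_island SD.1 SD.2 infG wfs cs.
  exists i; split=> //; split=> // j; rewrite in_cons => /predU1P[->|/wfs] //.
have good0 : good [::] by split=> //; exact: consistent_nil.
have /choice[step stepP] : forall sSD : seq island * ({fset G} * {fset G}),
    exists i, good sSD.1 -> extends sSD.1 sSD.2 i.
  move=> [s SD] /=; have [gs|gs] := pselect (good s).
    by have [i iP] := ext s SD gs; exists i.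
  by have [i _] := ext [::] SD good0; exists i => /gs.
have [e eP] := surjection_of_countable (fset0, fset0 : {fset G})
  (countable_pair (countable_fset_type cG) (countable_fset_type cG)).
pose st := fix st n := if n is m.+1 then step (st m, e m) :: st m else [::].
have stP n : good (st n).
  by elim: n => //= n IH; have [] := stepP (st n, e n) IH.
pose I n := step (st n, e n).
have IP n : extends (st n) (e n) (I n) := stepP (st n, e n) (stP n).
have Ist n m : (n < m)%N -> I n \in st m.
  elim: m => //= m IH; rewrite ltnS leq_eqVlt in_cons => /predU1P[->|/IH ->].
    by rewrite eqxx.
  by rewrite orbT.
exists (code \o I), (code_dom \o I), (color \o I); split.
- by move=> n; have [] := IP n.
- by move=> S D; have [n nSD] := eP (S, D); exists n; have := IP n; rewrite nSD => -[].
- move=> x l lP.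
  have lt_l ng : ng \in l -> (ng.1 < (\max_(ng <- l) ng.1).+1)%N.
    by move=> ngl; exact: (@leq_bigmax_seq _ l predT (fun ng => ng.1) ng ngl isT).
  have [wfN cN] := stP (\max_(ng <- l) ng.1).+1.
  have /nonnegligible_free[y yl] :
      ~ P.-negligible (joint_event [seq (I ng.1, ng.2) | ng <- l]).
    apply: (cN x) => _ /mapP[ng ngl ->] /=.
    by split; [exact: Ist (lt_l _ ngl)|exact: lP].
  exists y => ng ngl; have [_ _ _ cI] := wfN _ (Ist _ _ (lt_l ng ngl)).
  by apply: cI; apply: (yl (I ng.1, ng.2)); apply/mapP; exists ng.
Qed.

End Islands.

(** * Open subsets of the free part of the shift *)

Section FreeSubshift.
Variable G : groupType.
Local Notation cantor := (prod_topology (fun _ : G => bool)).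
Local Notation F2 := (set_type (free_part bool G : set cantor)).

Lemma nbhs_cylinder (x : cantor) (D : {fset G}) :
  nbhs x [set y : cantor | agree_on D x y].
Proof.
have -> : [set y : cantor | agree_on D x y]
    = \bigcap_(g in [set` D]) [set y : cantor | x g = y g].
  by apply/seteqP; split=> y.
apply: filter_bigI => g _.
have : nbhs x (proj g @^-1` [set x g]).
  by apply: (@proj_continuous _ (fun _ : G => bool) g x); exact: discrete_set1.
by apply: filterS => y /= <-.
Qed.

(** Cylinders around [x] form a base of neighborhoods: the filter that they
    generate converges to [x] coordinate by coordinate. *)
Lemma cylinder_nbhs (x : cantor) (A : set cantor) :
  nbhs x A -> exists D : {fset G}, [set y | agree_on D x y] `<=` A.
Proof.
pose cyl : set_system cantor :=
  [set A | exists D : {fset G}, [set y | agree_on D x y] `<=` A].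
have cylF : Filter cyl.
  split; first by exists fset0.
    move=> B C [D DB] [E EC]; exists (D `|` E)%fset => y xy; split.
      by apply: DB => g gD; apply: xy; rewrite in_fsetU gD.
    by apply: EC => g gE; apply: xy; rewrite in_fsetU gE orbT.
  by move=> B C BC [D DB]; exists D => y /DB/BC.
suff : cyl --> x by apply.
apply/cvg_sup => g B [_ [[C oC <-] Cx] CB].
exists [fset g]%fset => y xy; apply: CB => /=.
by rewrite -(xy g) ?in_fset1.
Qed.

Lemma open_free_partP (A : set F2) :
  open A <-> forall x, A x -> exists D : {fset G},
    forall y, agree_on D (set_val x) (set_val y) -> A y.
Proof.
split=> [[V oV <-] x /= Vx|HA].
  have [D DV] := cylinder_nbhs (open_nbhs_nbhs (conj oV Vx)).
  by exists D => y /DV.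
exists [set z : cantor | exists x (D : {fset G}),
  [/\ A x, agree_on D (set_val x) z &
      forall y, agree_on D (set_val x) (set_val y) -> A y]].
  rewrite openE => z [x [D [Ax xz DA]]]; apply: filterS (nbhs_cylinder z D).
  by move=> u zu; exists x, D; split=> // g gD; rewrite xz // zu.
apply/seteqP; split=> [y [x [D [_ xy]]]|x Ax]; first by apply.
by have [D DA] := HA x Ax; exists x, D.
Qed.

End FreeSubshift.

(** * Pulling a solution back to the free part of the shift *)

Lemma unit_itv1 (R : realType) : (1%R : R) \in (`[0%R, 1%R] : set R).
Proof. by rewrite inE /= in_itv /= lexx ler01. Qed.

Lemma free_part_comp (G : groupType) (T U : Type) (j : T -> U) (x : G -> T) :
  injective j -> free_part T G x -> free_part U G (j \o x).
Proof.
move=> jI fx g g1 gx; apply: (fx g g1); apply/funext => d; apply: jI.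
exact: (congr1 (@^~ d) gx).
Qed.

Lemma free_part_embedding (R : realType) (G : groupType) :
  exists j : free_part bool G -> free_part (unit_itv R) G,
    forall g x, j (free_shift g x) = free_shift g (j x).
Proof.
pose u b : unit_itv R := if b then SigSub (unit_itv1 R) else SigSub (unit_itv0 R).
have uI : injective u.
  by move=> [] [] // /(congr1 set_val) /= /eqP; rewrite ?oner_eq0 // eq_sym oner_eq0.
exists (fun x => SigSub (mem_set (free_part_comp uI (set_valP x)))) => g x.
exact: val_inj.
Qed.

Lemma baire_property_open (T : topologicalType) (A : set T) :
  open A -> baire_property A.
Proof.
move=> oA; exists A => //; rewrite setYK; exists (fun=> set0) => // n.
by rewrite /nowhere_dense closure0 interior0.
Qed.

(** * Points avoiding the codes *)

Section Uncoded.
Variable G : groupType.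
Local Notation F2 :=
  (set_type (free_part bool G : set (prod_topology (fun _ : G => bool)))).
Variables (C : nat -> G -> bool) (E : nat -> {fset G}).
Hypothesis freeC : forall n, free_part bool G (C n).
Hypothesis denseC : forall S D : {fset G}, exists n,
  agree_on D (fun d => d \in S) (C n) /\ {subset D <= E n}.

(** The points whose shift by [g] lies in no code. *)
Definition uncoded (g : G) : set F2 :=
  [set x | forall n, ~ agree_on (E n) (shift_act g (set_val x)) (C n)].

Lemma uncoded_nowhere_dense g : nowhere_dense (uncoded g).
Proof.
have clU : closed (uncoded g).
  rewrite -openC; apply/open_free_partP => x /existsNP[n /contrapT xn].
  exists [fset e * g | e in E n]%g%fset => y xy /(_ n); apply=> e eE.
  by rewrite -(xn e eE); apply/esym/xy/imfsetP; exists e.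
rewrite /nowhere_dense -(closure_id _).1 //; apply/seteqP; split=> // x.
have /open_free_partP/(_ x) io := open_interior (uncoded g).
move=> /io[D xD].
(* if an open set avoided the codes, some code would refine the shift by [g] of
   a cylinder around [x] inside it; its centre, shifted back, is free *)
pose S := [fset (d * g^-1)%g | d in D & set_val x d]%fset.
have [n [Sn DE]] := denseC S [fset (d * g^-1)%g | d in D]%fset.
pose y : F2 := free_shift g^-1%g (SigSub (mem_set (@freeC n))).
have /xD/interior_subset/(_ n) : agree_on D (set_val x) (set_val y).
  move=> d dD; rewrite [RHS](_ : _ = C n (d * g^-1)%g) // -Sn; last first.
    by apply/imfsetP; exists d.
  apply/idP/imfsetP => [xd|[e /=]].
    by exists d => //=; rewrite inE /= dD.
  by rewrite inE /= => /andP[_ xe] /mulIg ->.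
by apply=> e eE; rewrite /y /= -shiftM mulgV shift1.
Qed.

End Uncoded.

(** * Solutions *)

Lemma solution_allowed (G : groupType) (X : Type) (act : G -> X -> X)
    (Pi : LCL G) (f : X -> labels Pi) (a : window Pi -> labels Pi) (x : X) :
  solution act f -> (forall w, a w = f (act (val w) x)) ->
  [ffun w => a w] \in allowed Pi.
Proof.
by move=> fsol /funext ->; exact: fsol.
Qed.

Section Conclusion.
Variables (R : realType) (G : groupType) (Pi : LCL G).
Local Notation F2 :=
  (set_type (free_part bool G : set (prod_topology (fun _ : G => bool)))).

Lemma finite_group_BaireSHIFT : finite_set [set: G] ->
  FFIID R Pi -> BaireSHIFT Pi.
Proof.
move=> /finite_fsetP[D GD] [P [_ [f [fsol _]]]].
have [j jE] := free_part_embedding R G.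
exists (f \o j); split=> [x|B].
  by apply: (solution_allowed fsol (x := j x)) => w /=; rewrite jE.
apply: baire_property_open; apply/open_free_partP => x Bx; exists D => y xy.
suff -> : y = x by [].
apply: val_inj; apply/funext => g; apply: esym; apply: (xy g).
by have : [set: G] g by []; rewrite GD.
Qed.

Lemma infinite_group_BaireSHIFT : countable [set: G] -> ~ finite_set [set: G] ->
  FFIID R Pi -> BaireSHIFT Pi.
Proof.
move=> cG infG [P [HP [f [fsol ff]]]].
have [C [E [c [freeC denseC joint]]]] := coding_sequence HP cG ff infG.
have [j jE] := free_part_embedding R G.
pose codes n (x : G -> bool) := agree_on (E n) x (C n).
pose coded (x : F2) := forall g, exists n, codes n (shift_act g (set_val x)).
have /choice[h hP] : forall x : F2, exists a,
    (coded x -> exists2 n, codes n (set_val x) & a = c n) /\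
    (~ coded x -> a = f (j x)).
  move=> x; have [cx|ncx] := pselect (coded x); last by exists (f (j x)).
  have [n xn] := cx 1%g; rewrite shift1 in xn.
  by exists (c n); split=> // _; exists n.
have coded_shift g (x : F2) : coded x <-> coded (free_shift g x).
  split=> cx k; [have [n] := cx (k * g)%g|have [n] := cx (k * g^-1)%g].
    by exists n; rewrite /codes -shiftM.
  by exists n; move: p; rewrite /codes /= -shiftM mulgVK.
exists h; split=> [x|B].
  have [cx|ncx] := pselect (coded x); last first.
    apply: (solution_allowed fsol (x := j x)) => w.
    by rewrite (hP _).2 ?jE // -coded_shift.
  have /choice[N NP] : forall g, exists n,
      codes n (shift_act g (set_val x)) /\ h (free_shift g x) = c n.
    move=> g; have [n xn hn] := (hP (free_shift g x)).1 ((coded_shift g x).1 cx).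
    by exists n.
  have [|y yP] := joint (set_val x) [seq (N g, g) | g <- enum_fset (window Pi)].
    by move=> _ /mapP[g _ ->]; exact: (NP g).1.
  apply: (solution_allowed fsol (x := y)) => w; rewrite (NP _).2; apply: esym.
  by apply: (yP (N (val w), val w)); apply/mapP; exists (val w) => //; exact: valP.
(* on coded points, the preimage of [B] coincides with an open set *)
exists [set x : F2 | exists2 n, codes n (set_val x) & B (c n)].
  apply/open_free_partP => x [n xn Bn]; exists (E n) => y xy; exists n => //.
  by move=> g gE; rewrite -(xy g gE) xn.
have [e eP] := surjection_of_countable 1%g cG.
exists (fun n => uncoded C E (e n)) => [n|x xD].
  exact: uncoded_nowhere_dense.
apply: contrapT => xC; have cx : coded x.
  move=> g; apply: contrapT => /forallNP xg; apply: xC.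
  by have [n en] := eP g; exists n => //; rewrite en.
have [n xn hn] := (hP x).1 cx.
have unique m : codes m (set_val x) -> c m = c n.
  move=> xm; have [|y yP] := joint (set_val x) [:: (m, 1%g); (n, 1%g)].
    by move=> mn; rewrite !inE => /orP[] /eqP -> /=; rewrite shift1.
  rewrite -(yP (m, 1%g)) ?mem_head // -(yP (n, 1%g)) //.
  by rewrite in_cons mem_head orbT.
case: xD => -[]; first by rewrite /= hn => Bn; apply; exists n.
by move=> [m xm Bm]; apply; rewrite /= hn -(unique m xm).
Qed.

End Conclusion.

Theorem theorem1p19 (R : realType) (G : groupType) (fgG : finitely_generated G)
    (Pi : LCL G) :
  FFIID R Pi -> BaireSHIFT Pi.
Proof.
have [finG|infG] := pselect (finite_set [set: G]).
  exact: finite_group_BaireSHIFT.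
exact: infinite_group_BaireSHIFT (finitely_generated_countable fgG) infG.
Qed.
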